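(* There is an $\omega$-stable complete first-order theory $T$ of (Morley) rank $2$ with NDOP, a model $M$ of $T$, and a subset $A\subseteq M$ such that $A$ is not benign in $M$.
   Context: NDOP means that $T$ does not have the dimensional order property (Shelah). Let $L$ be the language of $M$ and let $L^*=L\cup\{P\}$, where $P$ is a new unary predicate; view $(M,A)$ as the $L^*$-structure in which $P$ is interpreted as $A$. $\operatorname{tp}(\alpha/A)$ denotes the complete $L$-type of $\alpha$ over $A$ in $M$, and $\operatorname{tp}_*(\alpha/A)$ the complete $L^*$-type of $\alpha$ over $A$ in $(M,A)$. The set $A$ is benign in $M$ if for all $\alpha,\beta\in M$ (finite tuples of the same length), $\operatorname{tp}(\alpha/A)=\operatorname{tp}(\beta/A)$ implies $\operatorname{tp}_*(\alpha/A)=\operatorname{tp}_*(\beta/A)$. *)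

(* Defs.v *)
From mathcomp Require Import all_boot.
From mathcomp Require Import boolp classical_sets functions cardinality.

Set Implicit Arguments.
Unset Strict Implicit.
Unset Printing Implicit Defensive.

Local Open Scope classical_set_scope.
Local Open Scope card_scope.

Record language := Language {
  func : Type;
  rel_sym : Type;
  func_arity : func -> nat;
  rel_arity : rel_sym -> nat }.

Record structure (L : language) := Structure {
  carrier :> Type;
  carrier_inhabited : inhabited carrier;
  func_interp : forall f : func L, ('I_(func_arity f) -> carrier) -> carrier;
  rel_interp : forall r : rel_sym L, ('I_(rel_arity r) -> carrier) -> Prop }.

(* The free variables of a formula are the elements of a type [X]; a
   quantifier binds the variable [None] of [option X].  A formula with
   parameters in [A : set M] and free variables in [X] is thus a formula over
   [X + A], the variables in [A] being evaluated as themselves. *)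
Inductive term (L : language) (X : Type) : Type :=
| Var of X
| App (f : func L) of ('I_(func_arity f) -> term L X).

Inductive formula (L : language) (X : Type) : Type :=
| Falsum
| Equal of term L X & term L X
| Rel (r : rel_sym L) of ('I_(rel_arity r) -> term L X)
| Imp of formula L X & formula L X
| Forall of formula L (option X).

Arguments Falsum {L X}.

Definition Not L X (phi : formula L X) : formula L X := Imp phi Falsum.

Notation sentence L := (formula L void).

Fixpoint eval L (M : structure L) X (v : X -> M) (t : term L X) : M :=
  match t with
  | Var x => v x
  | App f ts => func_interp (fun i => eval v (ts i))
  end.

Fixpoint sat L (M : structure L) X (v : X -> M) (phi : formula L X) : Prop :=
  match phi with
  | Falsum => False
  | Equal t u => eval v t = eval v u
  | Rel r ts => rel_interp (fun i => eval v (ts i))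
  | Imp phi1 phi2 => sat v phi1 -> sat v phi2
  | Forall phi1 => forall a : M, sat (fun o => oapp v a o) phi1
  end.

Definition holds L (M : structure L) (phi : sentence L) : Prop :=
  sat (of_void M) phi.

Definition models L (M : structure L) (T : set (sentence L)) : Prop :=
  forall phi, T phi -> holds M phi.

Definition entails L (T : set (sentence L)) (phi : sentence L) : Prop :=
  forall M : structure L, models M T -> holds M phi.

Definition complete_theory L (T : set (sentence L)) : Prop :=
  (exists M : structure L, models M T) /\
  (forall phi, entails T phi \/ entails T (Not phi)).

Definition join_val (X Y M : Type) (v : X -> M) (w : Y -> M) (z : X + Y) : M :=
  match z with inl x => v x | inr y => w y end.

Definition sat_over L (M : structure L) (A : set M) X (v : X -> M)
    (phi : formula L (X + A)) : Prop :=
  sat (join_val v (fun a : A => \val a)) phi.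

Definition definable L (M : structure L) (A : set M) X (D : set (X -> M)) :
    Prop :=
  exists phi : formula L (X + A), D = [set v | sat_over v phi].

Definition same_type L (M : structure L) (A : set M) n
    (alpha beta : 'I_n -> M) : Prop :=
  forall phi : formula L ('I_n + A), sat_over alpha phi <-> sat_over beta phi.

Definition finitely_satisfiable L (M : structure L) (A : set M) n
    (p : set (formula L ('I_n + A))) : Prop :=
  forall F : set (formula L ('I_n + A)), finite_set F -> F `<=` p ->
    exists x : 'I_n -> M, forall phi, F phi -> sat_over x phi.

Definition type_space L (M : structure L) (A : set M) n :
    set (set (formula L ('I_n + A))) :=
  [set p | finitely_satisfiable p /\ forall phi, p phi \/ p (Not phi)].

Definition realized L (M : structure L) (A : set M) n
    (p : set (formula L ('I_n + A))) : Prop :=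
  exists x : 'I_n -> M, forall phi, p phi -> sat_over x phi.

Definition omega_stable L (T : set (sentence L)) : Prop :=
  [/\ countable [set: func L], countable [set: rel_sym L] &
    forall M : structure L, models M T -> forall A : set M, countable A ->
    forall n, countable (@type_space L M A n)].

Definition omega_saturated L (M : structure L) : Prop :=
  forall (A : set M) n (p : set (formula L ('I_n + A))),
    finite_set A -> type_space p -> realized p.

Fixpoint morley_rank_ge L (M : structure L) k (n : nat)
    (D : set ('I_k -> M)) : Prop :=
  match n with
  | 0 => D !=set0
  | n'.+1 => exists Y : nat -> set ('I_k -> M),
      (forall i, [/\ definable [set: M] (Y i), Y i `<=` D &
                     morley_rank_ge n' (Y i)]) /\
      (forall i j, i <> j -> Y i `&` Y j = set0)
  end.

(* The Morley rank of the formula x = x, computed as usual in an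
   omega-saturated model; it does not depend on the choice of that model. *)
Definition has_morley_rank L (T : set (sentence L)) (n : nat) : Prop :=
  exists M : structure L,
    [/\ models M T, omega_saturated M,
        morley_rank_ge n [set: 'I_1 -> M] &
        ~ morley_rank_ge n.+1 [set: 'I_1 -> M]].

Definition small L (C : structure L) (A : set C) : Prop :=
  ~ ([set: C] #<= A).

Definition saturated L (C : structure L) : Prop :=
  forall (A : set C) n (p : set (formula L ('I_n + A))),
    small A -> type_space p -> realized p.

Definition divides L (C : structure L) (A : set C) n (D : set ('I_n -> C)) :
    Prop :=
  exists m (phi : formula L ('I_n + 'I_m)) (b : 'I_m -> C),
    D = [set x | sat (join_val x b) phi] /\
    exists (bs : nat -> 'I_m -> C) (k : nat),
      (forall i, same_type A (bs i) b) /\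
      (forall s : 'I_k -> nat, injective s ->
         ~ exists x, forall i, sat (join_val x (bs (s i))) phi).

Definition forks L (C : structure L) (A : set C) n (D : set ('I_n -> C)) :
    Prop :=
  exists r (E : 'I_r -> set ('I_n -> C)),
    (forall j, divides A (E j)) /\ (forall x, D x -> exists j, E j x).

(* for every finite tuple a of elements of M1, tp(a/M2) does not fork over M0
   (in the intended use, M0 is contained in M1 and in M2) *)
Definition independent L (C : structure L) (M0 M1 M2 : set C) : Prop :=
  forall n (a : 'I_n -> C), (forall i, M1 (a i)) ->
  forall D : set ('I_n -> C), definable M2 D -> D a -> ~ forks M0 D.

(* equality of strong types over A: E ranges over the A-definable equivalence
   relations on C^n with finitely many classes *)
Definition same_strong_type L (C : structure L) (A : set C) n
    (alpha beta : 'I_n -> C) : Prop :=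
  forall E : set ('I_n + 'I_n -> C), definable A E ->
    (forall x, E (join_val x x)) ->
    (forall x y, E (join_val x y) -> E (join_val y x)) ->
    (forall x y z, E (join_val x y) -> E (join_val y z) ->
                   E (join_val x z)) ->
    (exists k (r : 'I_k -> ('I_n -> C)),
       forall x, exists i, E (join_val x (r i))) ->
    E (join_val alpha beta).

Definition elementary_on L (M N : structure L) (A : set M) (g : M -> N) :
    Prop :=
  forall n (phi : formula L 'I_n) (a : 'I_n -> M), (forall i, A (a i)) ->
    (sat a phi <-> sat (g \o a) phi).

Definition elementary_submodel L (C : structure L) (A : set C) : Prop :=
  exists (N : structure L) (f : N -> C),
    elementary_on [set: N] f /\ A = range f.

(* F^a_kappa-saturation for kappa = aleph_0, which is kappa_r(T) for
   superstable, in particular for omega-stable, T: every strong type over a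
   finite subset is realized. *)
Definition a_saturated L (C : structure L) (N : set C) : Prop :=
  elementary_submodel N /\
  forall B : set C, finite_set B -> B `<=` N ->
  forall n (c : 'I_n -> C), exists c' : 'I_n -> C,
    (forall i, N (c' i)) /\ same_strong_type B c' c.

Definition a_model L (C : structure L) (N : set C) : Prop :=
  small N /\ a_saturated N.

Definition a_prime L (C : structure L) (B N : set C) : Prop :=
  [/\ a_model N, B `<=` N &
    forall N' : set C, a_model N' -> B `<=` N' ->
    exists g : C -> C, [/\ elementary_on N g,
                          (forall x, N x -> N' (g x)) &
                          (forall x, B x -> g x = x)]].

Definition a_minimal L (C : structure L) (B N : set C) : Prop :=
  [/\ a_model N, B `<=` N &
    forall N' : set C, a_model N' -> B `<=` N' -> N' `<=` N -> N' = N].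

(* The dimensional order property, for superstable T: Shelah, Classification
   Theory, Chapter X, Section 2.  The saturated model C plays the role of the
   monster model; it ranges over all saturated models of T, which for
   omega-stable T exist in every infinite cardinality. *)
Definition dop L (T : set (sentence L)) : Prop :=
  exists C : structure L, models C T /\ saturated C /\
  exists M0 M1 M2 N : set C,
    [/\ a_model M0, a_model M1 & a_model M2] /\
    [/\ M0 `<=` M1 `&` M2, independent M0 M1 M2,
        a_prime (M1 `|` M2) N & ~ a_minimal (M1 `|` M2) N].

Definition ndop L (T : set (sentence L)) : Prop := ~ dop T.

(* the language L u {P}; the new unary predicate P is [None] *)
Definition add_pred (L : language) : language :=
  {| func := func L;
     rel_sym := option (rel_sym L);
     func_arity := @func_arity L;
     rel_arity := fun r => oapp (@rel_arity L) 1 r |}.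

Definition expand_rel L (M : structure L) (A : set M)
    (r : option (rel_sym L)) : ('I_(oapp (@rel_arity L) 1 r) -> M) -> Prop :=
  match r with
  | Some r => @rel_interp L M r
  | None => fun x => A (x ord0)
  end.

Definition expand L (M : structure L) (A : set M) : structure (add_pred L) :=
  {| carrier := carrier M;
     carrier_inhabited := carrier_inhabited M;
     func_interp := @func_interp L M : forall f : func (add_pred L),
       ('I_(func_arity f) -> carrier M) -> carrier M;
     rel_interp := @expand_rel L M A : forall r : rel_sym (add_pred L),
       ('I_(rel_arity r) -> carrier M) -> Prop |}.

Definition benign L (M : structure L) (A : set M) : Prop :=
  forall n (alpha beta : 'I_n -> M),
    same_type A alpha beta ->
    same_type (M := expand A) A alpha beta.

(* Main.v *)
(* The theory is that of the grid nat * nat in which rows and columns are told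
   apart from each other but neither family is named: a permutation of the rows,
   a permutation of the columns and the exchange of both families are
   automorphisms.  Elimination of quantifiers is a back and forth between
   arbitrary infinite grids X * Y: a formula only depends on which coordinates
   of its arguments are equal.  Every model is such a grid; omega-stability
   follows by counting ultrafilters on tuples, and the rank is 2 because a
   definable set missing the generic points lies in finitely many lines.
   The theory has NDOP because an a-model containing M1 and M2 contains the
   grid spanned by their coordinates, which is already an a-model.
   The set A is the graph of an injective, non-surjective map from rows to
   columns.  Finite parts of A are symmetric under exchange of rows and columns,
   so (0, 2) and (1, 1) have the same type over A; but every row meets A while
   some column does not, so that A itself is not symmetric. *)

From Stdlib Require List.
Require Import Defs.
From mathcomp Require Import all_boot.
From mathcomp Require Import boolp classical_sets functions cardinality filter.

Set Implicit Arguments.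
Unset Strict Implicit.
Unset Printing Implicit Defensive.

Local Open Scope classical_set_scope.
Local Open Scope card_scope.

(** * Grids and the language of parallelism *)

Definition grid_lang : language :=
  {| func := void; rel_sym := unit;
     func_arity := of_void nat; rel_arity := fun=> 4 |}.

Definition quad T (a b c d : T) (i : 'I_4) : T := nth a [:: a; b; c; d] i.

Lemma quad_eta T (u : 'I_4 -> T) :
  u = quad (u ord0) (u (inord 1)) (u (inord 2)) (u (inord 3)).
Proof.
apply/funext; case=> -[|[|[|[|i]]]] // Hi; rewrite /quad /=;
  by congr u; apply/val_inj; rewrite /= ?inordK.
Qed.

Definition Par V (a b c d : V) : formula grid_lang V :=
  @Rel grid_lang V tt (quad (Var _ a) (Var _ b) (Var _ c) (Var _ d)).

Definition par (N : structure grid_lang) (a b c d : N) : Prop :=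
  @rel_interp grid_lang N tt (quad a b c d).

Lemma sat_Par (N : structure grid_lang) V (v : V -> N) a b c d :
  sat v (Par a b c d) <-> par (v a) (v b) (v c) (v d).
Proof.
rewrite /Par /par /=; set f := (X in rel_interp X <-> _).
suff -> : f = quad (v a) (v b) (v c) (v d) by [].
by apply/funext; case=> -[|[|[|[|i]]]].
Qed.

Lemma termE V (t : term grid_lang V) : exists x, t = Var grid_lang x.
Proof. by case: t => [x|[]]; exists x. Qed.

(* The quadruples [a, b, c, d] such that the line [ab] exists and either both
   lines [ab] and [cd] are rows or both are columns ([c = d] is allowed). *)
Definition parallel (N X Y : Type) (p1 : N -> X) (p2 : N -> Y) (a b c d : N) :=
  a <> b /\ (p1 a = p1 b /\ p1 c = p1 d \/ p2 a = p2 b /\ p2 c = p2 d).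

(** The coordinate maps need not be surjective, so that a subset of a grid can keep the ambient
    maps; infinity is therefore asked of the ranges. *)
Record grid (N : structure grid_lang) (X Y : Type) (p1 : N -> X) (p2 : N -> Y)
    : Prop := Grid {
  grid_inj : forall p q, p1 p = p1 q -> p2 p = p2 q -> p = q;
  grid_rect : forall p q, exists r, p1 r = p1 p /\ p2 r = p2 q;
  grid_infinite1 : infinite_set (range p1);
  grid_infinite2 : infinite_set (range p2);
  grid_par : forall a b c d, par a b c d <-> parallel p1 p2 a b c d }.

Lemma grid_swap (N : structure grid_lang) X Y (p1 : N -> X) (p2 : N -> Y) :
  grid p1 p2 -> grid p2 p1.
Proof.
case=> inj rect i1 i2 D; split=> // [p q E2 E1|p q|a b c d].
- exact: inj.
- by have [r [E1 E2]] := rect q p; exists r.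
- by rewrite D /parallel; split=> -[ne [E|E]]; split; auto.
Qed.

(** * Back and forth between infinite grids *)

Lemma infinite_fresh T (R F : set T) :
  infinite_set R -> finite_set F -> exists x, R x /\ ~ F x.
Proof.
move=> iR fF; have [x [Rx Fx]] := infinite_setN0 (infinite_setD iR fF).
by exists x.
Qed.

Definition same_eq V X X' (S : set V) (f : V -> X) (f' : V -> X') : Prop :=
  forall z z', S z -> S z' -> (f z = f z' <-> f' z = f' z').

Lemma same_eq_sym V X X' (S : set V) (f : V -> X) (f' : V -> X') :
  same_eq S f f' -> same_eq S f' f.
Proof. by move=> H z z' Sz Sz'; split=> /(H _ _ Sz Sz'). Qed.

Lemma same_eqS V X X' (S S' : set V) (f : V -> X) (f' : V -> X') :
  S `<=` S' -> same_eq S' f f' -> same_eq S f f'.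
Proof. by move=> sub H z z' /sub Sz /sub Sz'; exact: H. Qed.

(** One step of the back and forth in a single coordinate: a value already taken on [S] is copied, a
    new one is answered by a fresh element of [R]. *)
Lemma same_eq_extend V X X' (S : set V) (f : V -> X) (f' : V -> X')
    (R : set X') (x : X) :
  finite_set S -> infinite_set R -> (forall z, S z -> R (f' z)) ->
  same_eq S f f' ->
  exists x', R x' /\ forall z, S z -> (f z = x <-> f' z = x').
Proof.
move=> fS iR SR eqS; have [[z [Sz <-]]|no] := pselect (exists z, S z /\ f z = x).
  by exists (f' z); split=> [|y Sy]; [exact: SR | exact: eqS].
have [x' [Rx' fx']] := infinite_fresh iR (finite_image f' fS).
exists x'; split=> // z Sz; split=> E; first by case: no; exists z.
by case: fx'; exists z.
Qed.

Lemma preimage_Some_finite V (S : set (option V)) :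
  finite_set S -> finite_set (Some @^-1` S).
Proof. by apply: finite_preimage => x y _ _ []. Qed.

(* Back and forth: over an infinite grid a formula only sees which of the
   coordinates of finitely many of its arguments are equal. *)
Lemma grid_sat V (phi : formula grid_lang V) :
  exists S : set V, finite_set S /\
    forall (N : structure grid_lang) X Y (p1 : N -> X) (p2 : N -> Y)
           (N' : structure grid_lang) X' Y' (p1' : N' -> X') (p2' : N' -> Y') v w,
    grid p1 p2 -> grid p1' p2' ->
    same_eq S (p1 \o v) (p1' \o w) -> same_eq S (p2 \o v) (p2' \o w) ->
    (sat v phi <-> sat w phi).
Proof.
elim: V / phi =>
  [V|V t u|V [] ts|V phi [S [fS IS]] psi [S' [fS' IS']]|V phi [S [fS IS]]].
- by exists set0; split=> //; exact: finite_set0.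
- have [x ->] := termE t; have [y ->] := termE u.
  exists [set x; y]; split=> [|N X Y p1 p2 N' X' Y' p1' p2' v w G G' E1 E2 /=].
    exact: finite_set2.
  have S1 : [set x; y] x by left.
  have S2 : [set x; y] y by right.
  split=> E.
    by apply: (grid_inj G'); [apply/(E1 _ _ S1 S2)|apply/(E2 _ _ S1 S2)]; rewrite /= E.
  by apply: (grid_inj G); [apply/(E1 _ _ S1 S2)|apply/(E2 _ _ S1 S2)]; rewrite /= E.
- have -> : @Rel grid_lang V tt ts = @Rel grid_lang V tt (quad
    (ts ord0) (ts (inord 1)) (ts (inord 2)) (ts (inord 3))) by rewrite -quad_eta.
  have [a ->] := termE (ts ord0); have [b ->] := termE (ts (inord 1)).
  have [c ->] := termE (ts (inord 2)); have [d ->] := termE (ts (inord 3)).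
  rewrite -/(Par a b c d).
  exists [set a; b; c; d]; split=> [|N X Y p1 p2 N' X' Y' p1' p2' v w G G' E1 E2].
    exact: finite_set4.
  rewrite !sat_Par (grid_par G) (grid_par G') /parallel.
  set S := [set a; b; c; d] in E1 E2.
  have [Sa Sb Sc Sd] : [/\ S a, S b, S c & S d] by split; rewrite /S /=; auto.
  have E : v a = v b <-> w a = w b.
    split=> E.
      by apply: (grid_inj G'); [apply/(E1 _ _ Sa Sb)|apply/(E2 _ _ Sa Sb)]; rewrite /= E.
    by apply: (grid_inj G); [apply/(E1 _ _ Sa Sb)|apply/(E2 _ _ Sa Sb)]; rewrite /= E.
  have := E1 _ _ Sa Sb; have := E1 _ _ Sc Sd;
  have := E2 _ _ Sa Sb; have := E2 _ _ Sc Sd.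
  rewrite /=; tauto.
- exists (S `|` S'); split=> [|N X Y p1 p2 N' X' Y' p1' p2' v w G G' E1 E2 /=].
    by rewrite finite_setU.
  have H := IS _ _ _ _ _ _ _ _ _ _ v w G G'
    (same_eqS (@subsetUl _ _ _) E1) (same_eqS (@subsetUl _ _ _) E2).
  have H' := IS' _ _ _ _ _ _ _ _ _ _ v w G G'
    (same_eqS (@subsetUr _ _ _) E1) (same_eqS (@subsetUr _ _ _) E2).
  tauto.
- exists (Some @^-1` S); split; first exact: preimage_Some_finite.
  have fS' := preimage_Some_finite fS.
  suff imp : forall (N : structure grid_lang) X Y (p1 : N -> X) (p2 : N -> Y)
           (N' : structure grid_lang) X' Y' (p1' : N' -> X') (p2' : N' -> Y') v w,
    grid p1 p2 -> grid p1' p2' ->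
    same_eq (Some @^-1` S) (p1 \o v) (p1' \o w) ->
    same_eq (Some @^-1` S) (p2 \o v) (p2' \o w) ->
    sat v (Forall phi) -> sat w (Forall phi).
    move=> N X Y p1 p2 N' X' Y' p1' p2' v w G G' E1 E2; split.
      exact: imp G G' E1 E2.
    exact: imp G' G (same_eq_sym E1) (same_eq_sym E2).
  move=> N X Y p1 p2 N' X' Y' p1' p2' v w G G' E1 E2 /= vphi b.
  (* Row and column are answered independently, through [q1] and [q2]; the rectangle property merges
     the two answers into one point. *)
  have [x [[q1 _ <-] H1]] := same_eq_extend (p1' b) fS' (grid_infinite1 G)
    (fun z _ => imageT p1 (v z)) (same_eq_sym E1).
  have [y [[q2 _ <-] H2]] := same_eq_extend (p2' b) fS' (grid_infinite2 G)
    (fun z _ => imageT p2 (v z)) (same_eq_sym E2).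
  have [a [a1 a2]] := grid_rect G q1 q2.
  refine (proj1 (IS _ _ _ _ _ _ _ _ _ _ _ _ G G' _ _) (vphi a)).
    move=> [z|] [z'|] Sz Sz' //=; rewrite ?a1; first exact: E1.
      by apply: iff_sym; exact: H1.
    by split=> /esym/(H1 _ Sz')/esym.
  move=> [z|] [z'|] Sz Sz' //=; rewrite ?a2; first exact: E2.
    by apply: iff_sym; exact: H2.
  by split=> /esym/(H2 _ Sz')/esym.
Qed.

(** * Derived connectives *)

Section connectives.
Variables (L : language) (V : Type).
Implicit Types phi psi : formula L V.

Definition And phi psi := Not (Imp phi (Not psi)).
Definition Or phi psi := Imp (Not phi) psi.
Definition Ex (phi : formula L (option V)) := Not (Forall (Not phi)).

Variables (N : structure L) (v : V -> N).

Lemma sat_And phi psi : sat v (And phi psi) <-> sat v phi /\ sat v psi.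
Proof. by rewrite /=; split=> [H|[]]; [apply: contrapT|]; tauto. Qed.

Lemma sat_Or phi psi : sat v (Or phi psi) <-> sat v phi \/ sat v psi.
Proof. by rewrite /=; split=> [H|[]]; [apply: contrapT|..]; tauto. Qed.

Lemma sat_Imp phi psi : sat v (Imp phi psi) <-> (sat v phi -> sat v psi).
Proof. by []. Qed.

Lemma sat_Forall (phi : formula L (option V)) :
  sat v (Forall phi) <-> forall a, sat (fun o => oapp v a o) phi.
Proof. by []. Qed.

Lemma sat_Ex (phi : formula L (option V)) :
  sat v (Ex phi) <-> exists a, sat (fun o => oapp v a o) phi.
Proof.
rewrite /=; split=> [H|[a Ha] H]; last exact: (H a).
by apply: contrapT => no; apply: H => a Ha; apply: no; exists a.
Qed.

End connectives.

(** * Infinitely many rows and columns *)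

Section scattered.
Implicit Type N : structure grid_lang.

Definition apart N (p q : N) := p <> q /\ ~ par p q p q.

Definition Apart (V : Type) (p q : V) : formula grid_lang V :=
  And (Not (Equal (Var _ p) (Var _ q))) (Not (Par p q p q)).

Lemma sat_Apart N V (v : V -> N) p q :
  sat v (Apart p q) <-> apart (v p) (v q).
Proof. by rewrite /Apart sat_And /apart -sat_Par. Qed.

Fixpoint Apart_from (V : Type) (p : V) (s : seq V) : formula grid_lang V :=
  if s is q :: s' then And (Apart p q) (Apart_from p s') else Not Falsum.

Lemma sat_Apart_from N V (v : V -> N) p s :
  sat v (Apart_from p s) <-> forall q, List.In q s -> apart (v p) (v q).
Proof.
elim: s => [|q s IH]; first by rewrite /=; split.
rewrite [Apart_from _ _]/= sat_And sat_Apart IH.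
split=> [[pq ps] r [<- //|]|H]; first exact: ps.
by split=> [|r rs]; apply: H; [left|right].
Qed.

(* There are [k] pairwise non-collinear points; [s] accumulates the points
   quantified so far. *)
Fixpoint Scattered k (V : Type) (s : seq V) : formula grid_lang V :=
  if k is k'.+1 then
    Ex (And (Apart_from None (map Some s)) (Scattered k' (None :: map Some s)))
  else Not Falsum.

Lemma sat_Scattered_seq N V (v : V -> N) k (s : seq V) : sat v (Scattered k s) ->
  exists f : nat -> N,
    (forall i j, i < j < k -> apart (f j) (f i)) /\
    (forall i x, i < k -> List.In x s -> apart (f i) (v x)).
Proof.
elim: k V v s => [|k IH] V v s.
  have [p] := carrier_inhabited N.
  by exists (fun=> p); split=> [i j|i x] //; rewrite ltn0 andbF.
rewrite [Scattered _ _]/= => /sat_Ex[a /sat_And[]].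
move=> /sat_Apart_from as_ /IH[f [fij fs]].
have inS x : List.In x s -> List.In (Some x) (map Some s) by exact: List.in_map.
(* The outermost witness gets index [0]; the later ones are apart from it because it stands as
   [None] in the accumulated list. *)
exists (fun i => if i is i'.+1 then f i' else a); split=> [[|i] [|j]|[|i] x] //.
- by move=> jk; apply: (fs j None) => //; left.
- by rewrite !ltnS; exact: fij.
- by move=> _ /inS/as_.
- by rewrite ltnS => ik /inS xs; apply: (fs i (Some x)) => //; right.
Qed.

Variables (N : structure grid_lang) (X Y : Type) (p1 : N -> X) (p2 : N -> Y).
Hypothesis G : grid p1 p2.

Lemma grid_collinear a b :
  par a b a b <-> a <> b /\ (p1 a = p1 b \/ p2 a = p2 b).
Proof. by rewrite (grid_par G) /parallel; tauto. Qed.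

Lemma grid_apart a b : apart a b <-> p1 a <> p1 b /\ p2 a <> p2 b.
Proof.
rewrite /apart grid_collinear; split=> [[ne H]|[n1 n2]]; last first.
  by split=> [E|[_ []]] //; apply: n1; rewrite E.
by split=> E; apply: H; auto.
Qed.

Lemma list_finite T (s : seq T) : finite_set [set x | List.In x s].
Proof.
elim: s => [|x s IH] /=; first by rewrite (_ : mkset _ = set0).
rewrite (_ : mkset _ = [set x] `|` [set y | List.In y s]); last first.
  by apply/seteqP; split=> y /= [->|]; auto.
by rewrite finite_setU; split=> //; exact: finite_set1.
Qed.

Lemma grid_Scattered V (v : V -> N) k (s : seq V) : sat v (Scattered k s).
Proof.
elim: k V v s => [|k IH] V v s; first by move=> [].
rewrite [Scattered _ _]/=; apply/sat_Ex.
have fin := finite_image v (list_finite s).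
have [_ [[q1 _ <-] n1]] := infinite_fresh (grid_infinite1 G) (finite_image p1 fin).
have [_ [[q2 _ <-] n2]] := infinite_fresh (grid_infinite2 G) (finite_image p2 fin).
have [a [a1 a2]] := grid_rect G q1 q2.
exists a; apply/sat_And; split; last exact: IH.
apply/sat_Apart_from => q /List.in_map_iff[x [<- xs]] /=.
apply/grid_apart; rewrite a1 a2; split=> E.
  by apply: n1; exists (v x) => //; exists x.
by apply: n2; exists (v x) => //; exists x.
Qed.

End scattered.

Lemma infinite_range_seq T X (p : T -> X) :
  (forall k, exists f : nat -> T, forall i j, i < j < k -> p (f j) <> p (f i)) ->
  infinite_set (range p).
Proof.
move=> H /finite_setP[n An]; have [f fij] := H n.+1.
have : `I_n.+1 #<= `I_n.
  rewrite -(card_le_eqr An); apply: (@card_le_trans _ _ _ ((p \o f) @` `I_n.+1)).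
    have /inj_card_eq : {in `I_n.+1 &, injective (p \o f)}; last first.
      by rewrite card_eq_le => /andP[].
    move=> i j; rewrite !inE /= => ik jk E.
    by case: (ltngtP i j) => // ij; [case: (fij i j)|case: (fij j i)]; rewrite ?ij.
  by apply: subset_card_le => _ [i _ <-]; exists (f i).
by rewrite card_le_II ltnn.
Qed.

(** * Coordinates expressed by parallelism *)

Section coordinates.
Variable V : Type.

(** Reflexive and Euclidean, hence an equivalence relation; its classes are meant to be the lines
    parallel to [ab]. *)
Definition Eqrel (a b : V) : formula grid_lang V :=
  And (Forall (Par (Some a) (Some b) None None))
    (Forall (Forall (Forall
      (Imp (Par (Some (Some (Some a))) (Some (Some (Some b)))
                (Some (Some None)) (Some None))
      (Imp (Par (Some (Some (Some a))) (Some (Some (Some b)))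
                (Some (Some None)) None)
           (Par (Some (Some (Some a))) (Some (Some (Some b)))
                (Some None) None)))))).

Lemma sat_Eqrel (N : structure grid_lang) (v : V -> N) a b :
  sat v (Eqrel a b) <->
  (forall p, par (v a) (v b) p p) /\
  (forall p q r, par (v a) (v b) p q -> par (v a) (v b) p r ->
                 par (v a) (v b) q r).
Proof.
rewrite sat_And; split=> -[H1 H2]; split.
- by move=> p; move/sat_Forall: H1 => /(_ p)/sat_Par.
- move=> p q r; move/sat_Forall: H2 => /(_ p)/sat_Forall/(_ q)/sat_Forall/(_ r).
  by rewrite !sat_Imp !sat_Par.
- by apply/sat_Forall => p; apply/sat_Par; exact: H1.
- apply/sat_Forall => p; apply/sat_Forall => q; apply/sat_Forall => r.
  by rewrite !sat_Imp !sat_Par; exact: H2.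
Qed.

Definition Separating (a b c : V) : formula grid_lang V :=
  Forall (Forall
    (Imp (Par (Some (Some a)) (Some (Some b)) (Some None) None)
    (Imp (Par (Some (Some a)) (Some (Some c)) (Some None) None)
         (Equal (Var _ (Some None)) (Var _ None))))).

Lemma sat_Separating (N : structure grid_lang) (v : V -> N) a b c :
  sat v (Separating a b c) <->
  forall p q, par (v a) (v b) p q -> par (v a) (v c) p q -> p = q.
Proof.
split=> H.
  move=> p q; move/sat_Forall: H => /(_ p)/sat_Forall/(_ q).
  by rewrite !sat_Imp !sat_Par.
apply/sat_Forall => p; apply/sat_Forall => q.
by rewrite !sat_Imp !sat_Par; exact: H.
Qed.

Definition Rectangular (a b c : V) : formula grid_lang V :=
  Forall (Forall (Ex (And
    (Par (Some (Some (Some a))) (Some (Some (Some b)))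
         None (Some (Some None)))
    (Par (Some (Some (Some a))) (Some (Some (Some c)))
         None (Some None))))).

Lemma sat_Rectangular (N : structure grid_lang) (v : V -> N) a b c :
  sat v (Rectangular a b c) <->
  forall p q, exists r, par (v a) (v b) r p /\ par (v a) (v c) r q.
Proof.
split=> H.
  move=> p q; move/sat_Forall: H => /(_ p)/sat_Forall/(_ q)/sat_Ex[r].
  by rewrite sat_And !sat_Par; exists r.
apply/sat_Forall => p; apply/sat_Forall => q; have [r Hr] := H p q.
by apply/sat_Ex; exists r; rewrite sat_And !sat_Par.
Qed.

Definition Par_spec (a b c : V) : formula grid_lang V :=
  let l x := Some (Some (Some (Some x))) in
  let p := Some (Some (Some None)) in let q := Some (Some None) in
  let r := Some None in let s := None in
  let rhs := And (Not (Equal (Var _ p) (Var _ q)))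
    (Or (And (Par (l a) (l b) p q) (Par (l a) (l b) r s))
        (And (Par (l a) (l c) p q) (Par (l a) (l c) r s))) in
  Forall (Forall (Forall (Forall
    (And (Imp (Par p q r s) rhs) (Imp rhs (Par p q r s)))))).

Lemma sat_Par_spec (N : structure grid_lang) (v : V -> N) a b c :
  sat v (Par_spec a b c) <->
  forall p q r s, par p q r s <-> p <> q /\
    (par (v a) (v b) p q /\ par (v a) (v b) r s \/
     par (v a) (v c) p q /\ par (v a) (v c) r s).
Proof.
rewrite /Par_spec; split=> H.
  move=> p q r s; move/sat_Forall: H => /(_ p)/sat_Forall/(_ q).
  move=> /sat_Forall/(_ r)/sat_Forall/(_ s)/sat_And[].
  by rewrite !(sat_Imp, sat_And, sat_Or, sat_Par).
apply/sat_Forall => p; apply/sat_Forall => q; apply/sat_Forall => r.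
apply/sat_Forall => s; have [H1 H2] := H p q r s.
by rewrite !(sat_Imp, sat_And, sat_Or, sat_Par).
Qed.

(** Here [a] is a corner from which [ab] and [ac] point in the two directions. This axiomatizes
    grids up to the infinity of both families of lines. *)
Definition Coordinates (a b c : V) : formula grid_lang V :=
  And (And (Eqrel a b) (Eqrel a c))
    (And (Separating a b c) (And (Rectangular a b c) (Par_spec a b c))).

End coordinates.

Definition Has_coordinates V : formula grid_lang V :=
  Ex (Ex (Ex (Coordinates (Some (Some None)) (Some None) None))).

Definition nat_grid : structure grid_lang :=
  {| carrier := nat * nat;
     carrier_inhabited := inhabits (0, 0);
     func_interp := fun f : func grid_lang => match f with end;
     rel_interp := fun r : rel_sym grid_lang => fun u : 'I_4 -> nat * nat =>
       parallel fst snd (u ord0) (u (inord 1)) (u (inord 2)) (u (inord 3)) |}.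

Lemma nat_grid_grid : @grid nat_grid nat nat fst snd.
Proof.
split=> [[a b] [c d] /= -> -> //|p q|||a b c d].
- by exists (p.1, q.2).
- rewrite (_ : range _ = setT); first exact: infinite_nat.
  by apply/seteqP; split=> // n _; exists (n, 0).
- rewrite (_ : range _ = setT); first exact: infinite_nat.
  by apply/seteqP; split=> // n _; exists (0, n).
- rewrite /par /=; have := quad_eta (quad a b c d).
  move=> /(congr1 (fun f => (f ord0, f (inord 1), f (inord 2), f (inord 3)))).
  by rewrite /quad /= !inordK.
Qed.

Lemma grid_Has_coordinates (N : structure grid_lang) X Y (p1 : N -> X) (p2 : N -> Y)
    V (v : V -> N) : grid p1 p2 -> sat v (Has_coordinates V).
Proof.
move=> G; have [a] := carrier_inhabited N.
have [_ [[q1 _ <-] n1]] := infinite_fresh (grid_infinite1 G) (finite_set1 (p1 a)).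
have [_ [[q2 _ <-] n2]] := infinite_fresh (grid_infinite2 G) (finite_set1 (p2 a)).
(* [b] shares the first coordinate of [a] and [c] the second, so that [par a b] and [par a c] are
   the two equalities of coordinates. *)
have [b [b1 b2]] := grid_rect G a q2.
have [c [c1 c2]] := grid_rect G q1 a.
have Eab p q : par a b p q <-> p1 p = p1 q.
  rewrite (grid_par G) /parallel b1 b2; split=> [[ne [[_ //]|[E]]]|E].
    by case: n2 => /=; rewrite E.
  by split; [move=> E'; apply: n2; rewrite /= -b2 -E'|left].
have Eac p q : par a c p q <-> p2 p = p2 q.
  rewrite (grid_par G) /parallel c1 c2; split=> [[ne [[E]|[_ //]]]|E].
    by case: n1 => /=; rewrite E.
  by split; [move=> E'; apply: n1; rewrite /= -c1 -E'|right].
apply/sat_Ex; exists a; apply/sat_Ex; exists b; apply/sat_Ex; exists c.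
apply/sat_And; split; apply/sat_And; split; [| |
  apply/sat_Separating|apply/sat_And; split; [
  apply/sat_Rectangular|apply/sat_Par_spec]]; rewrite /=.
- apply/sat_Eqrel; split; first by move=> p; apply/Eab.
  by move=> p q r /Eab E /Eab E'; apply/Eab; rewrite -E.
- apply/sat_Eqrel; split; first by move=> p; apply/Eac.
  by move=> p q r /Eac E /Eac E'; apply/Eac; rewrite -E.
- by move=> p q /Eab E /Eac; exact: (grid_inj G).
- by move=> p q; have [r [r1 r2]] := grid_rect G p q; exists r; split; [apply/Eab|apply/Eac].
- by move=> p q r s; rewrite !Eab !Eac (grid_par G).
Qed.

Lemma sat_grid (N : structure grid_lang) V (v : V -> N) :
  sat v (Has_coordinates V) -> (forall k, sat v (Scattered k [::])) ->
  exists X Y (p1 : N -> X) (p2 : N -> Y), grid p1 p2.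
Proof.
move=> /sat_Ex[a /sat_Ex[b /sat_Ex[c /sat_And[]]]].
move=> /sat_And[/sat_Eqrel[r1 t1] /sat_Eqrel[r2 t2]].
move=> /sat_And[/sat_Separating inj] /sat_And[/sat_Rectangular rect].
move=> /sat_Par_spec spec scat; cbn in r1, t1, r2, t2, inj, rect, spec.
have s1 p q : par a b p q -> par a b q p by move=> pq; exact: t1 pq (r1 p).
have s2 p q : par a c p q -> par a c q p by move=> pq; exact: t2 pq (r2 p).
(* The class of a point, as a predicate on [N], will serve as its coordinate; extensionality turns
   equality of classes into the relation itself. *)
have E1 p q : par a b p = par a b q <-> par a b p q.
  split=> [-> //|pq]; apply/funext => r; apply/propext.
  by split=> [/(t1 _ _ _ pq)|/(t1 _ _ _ (s1 _ _ pq))].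
have E2 p q : par a c p = par a c q <-> par a c p q.
  split=> [-> //|pq]; apply/funext => r; apply/propext.
  by split=> [/(t2 _ _ _ pq)|/(t2 _ _ _ (s2 _ _ pq))].
exists (N -> Prop), (N -> Prop), (par a b), (par a c); split.
- by move=> p q /E1 pq /E2; exact: inj.
- by move=> p q; have [r [H1 H2]] := rect p q; exists r; split; [apply/E1|apply/E2].
- apply: infinite_range_seq => k; have [f [fij _]] := sat_Scattered_seq (scat k).
  exists f => i j /fij[ne np] /E1 E; apply: np; apply/spec; split=> //.
  by left.
- apply: infinite_range_seq => k; have [f [fij _]] := sat_Scattered_seq (scat k).
  exists f => i j /fij[ne np] /E2 E; apply: np; apply/spec; split=> //.
  by right.
- by move=> p q r s; rewrite spec /parallel !E1 !E2.
Qed.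

(** * The theory and its models *)

Definition grid_theory : set (sentence grid_lang) := holds nat_grid.

Lemma grid_theory_complete : complete_theory grid_theory.
Proof.
split; first by exists nat_grid.
by move=> phi; have [H|H] := pselect (holds nat_grid phi); [left|right]; move=> N; exact.
Qed.

(** [Has_coordinates] and all the [Scattered k] are sentences true in [nat_grid], so they pass to
    every model. *)
Lemma model_grid (N : structure grid_lang) : models N grid_theory ->
  exists X Y (p1 : N -> X) (p2 : N -> Y), grid p1 p2.
Proof.
move=> mN; apply: (@sat_grid N void (of_void N)).
  by apply: (mN (Has_coordinates void)); exact: grid_Has_coordinates nat_grid_grid.
by move=> k; apply: (mN (Scattered k _)); exact: grid_Scattered nat_grid_grid _ _ _ _.
Qed.

(** * Types as ultrafilters, omega-stability and saturation *)

Lemma type_ultra L (N : structure L) (A : set N) n (p : set (formula L ('I_n + A))) :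
  type_space p ->
  exists U : set_system ('I_n -> N), UltraFilter U /\
    forall phi, p phi -> U [set x | sat_over x phi].
Proof.
move=> [fin_sat _].
(* Finite satisfiability makes the solution sets of finite parts of [p] a filter base. An
   ultrafilter above it stands in for a realization of [p] in an elementary extension. *)
pose B (S : set ('I_n -> N)) := exists F : set (formula L ('I_n + A)),
  [/\ finite_set F, F `<=` p & [set x | forall phi, F phi -> sat_over x phi] `<=` S].
have PB : ProperFilter B.
  split=> [[F [fF Fp F0]]|].
    by have [x Fx] := fin_sat F fF Fp; exact: (F0 x).
  split.
  - by exists set0; split=> //; exact: finite_set0.
  - move=> S S' [F [fF Fp FS]] [F' [fF' Fp' FS']]; exists (F `|` F'); split.
    + by rewrite finite_setU.
    + by rewrite subUset.
    + by move=> x H; split; [apply: FS|apply: FS'] => phi Fphi; apply: H; [left|right].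
  - by move=> S S' SS' [F [fF Fp FS]]; exists F; split=> // x /FS/SS'.
have [U [UU BU]] := ultraFilterLemma PB; exists U; split=> // phi pphi; apply: BU.
exists [set phi]; split; first exact: finite_set1.
  by move=> _ ->.
by move=> x; apply.
Qed.

(** Lets a single point represent the ultrafilter for finitely many questions at once. *)
Lemma ultra_decides T (U : set_system T) I (D : set I) (f : I -> set T) :
  UltraFilter U -> finite_set D ->
  U [set x | forall i, D i -> (f i x <-> U (f i))].
Proof.
move=> UU fD; have PU : ProperFilter U := ultra_proper.
have /finite_seqP[s Ds] := fD : finite_set (D : set {classic I}).
have {Ds} : forall i : {classic I}, D i -> i \in s by move=> i; rewrite Ds.
elim: s D {fD} => [|j s IH] D Ds.
  by apply: filterS filterT => x _ i /Ds.
have Us : U [set x | forall i, (D `\ j) i -> (f i x <-> U (f i))].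
  by apply: IH => i [/Ds]; rewrite in_cons => /orP[/eqP-> []|].
have [Uf|Uf] := in_ultra_setVsetC (f j) UU;
  apply: filterS (filterI Us Uf) => x [Hx fx] i Di.
  by have [->|ne] := pselect (i = j); [split|apply: Hx].
have [->|ne] := pselect (i = j); last exact: Hx.
split=> // Uf'; have [y [//]] := filter_ex (filterI Uf Uf').
Qed.

Section ultra_coordinates.
Variables (N : structure grid_lang) (A : set N) (n : nat).
Implicit Type U : set_system ('I_n -> N).

Definition valuation (x : 'I_n -> N) : 'I_n + A -> N :=
  join_val x (fun a : A => \val a).

Definition coord_eq X (q : N -> X) (z z' : 'I_n + A) : set ('I_n -> N) :=
  [set x | q (valuation x z) = q (valuation x z')].

Definition ultra_pattern X (q : N -> X) U (S : set ('I_n + A)) :=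
  [set x | forall z z', S z -> S z' ->
    (coord_eq q z z' x <-> U (coord_eq q z z'))].

Lemma ultra_patternP X (q : N -> X) U S :
  UltraFilter U -> finite_set S -> U (ultra_pattern q U S).
Proof.
move=> UU fS; have PU : ProperFilter U := ultra_proper.
have := ultra_decides (fun zz => coord_eq q zz.1 zz.2) UU (finite_setX fS fS).
by apply: filterS => x H z z' Sz Sz'; exact: (H (z, z')).
Qed.

Lemma ultra_pattern_same_eq X (q : N -> X) U U' S x y :
  (forall z z', U (coord_eq q z z') <-> U' (coord_eq q z z')) ->
  ultra_pattern q U S x -> ultra_pattern q U' S y ->
  same_eq S (q \o valuation x) (q \o valuation y).
Proof.
move=> UU' Hx Hy z z' Sz Sz'.
exact: iff_trans (Hx z z' Sz Sz') (iff_trans (UU' z z') (iff_sym (Hy z z' Sz Sz'))).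
Qed.

(* The code of [U] at [i] is the element of [A], if any, which has almost
   everywhere the same coordinate as the [i]-th entry. *)
Lemma ultra_code X (q : N -> X) : countable A ->
  exists (C : countType) (code : set_system ('I_n -> N) -> C),
  forall U U', UltraFilter U -> UltraFilter U' -> code U = code U' ->
    forall z z', U (coord_eq q z z') -> U' (coord_eq q z z').
Proof.
move=> /countable_injP[e e_inj].
pose at_ U i (o : option nat) := if o is Some k then
  exists a : A, e (val a) = k /\ U (coord_eq q (inl i) (inr a))
  else ~ exists a : A, U (coord_eq q (inl i) (inr a)).
have atP (Ui : set_system ('I_n -> N) * 'I_n) : exists o, at_ Ui.1 Ui.2 o.
  have [[a Ua]|no] := pselect (exists a : A, Ui.1 (coord_eq q (inl Ui.2) (inr a))).
    by exists (Some (e (val a))), a.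
  by exists None.
have [c cP] := choice atP.
(* The first function codes a parameter for each entry, or [None]; the second records equalities
   among the entries themselves. *)
exists ({ffun 'I_n -> option nat} * {ffun 'I_n * 'I_n -> bool})%type.
exists (fun U => ([ffun i => c (U, i)],
                  [ffun ij => `[< U (coord_eq q (inl ij.1) (inl ij.2)) >]])).
move=> U U' UU UU' [/ffunP E1 /ffunP E2] z z'.
have PU : ProperFilter U := ultra_proper.
have PU' : ProperFilter U' := ultra_proper.
have main i a : U (coord_eq q (inl i) (inr a)) -> U' (coord_eq q (inl i) (inr a)).
  move=> Ua; have := cP (U, i); have := cP (U', i); have := E1 i; rewrite !ffunE => ->.
  case: (c (U', i)) => [k|] /=; last by move=> _ []; exists a.
  move=> [b' [eb' Ub']] [b [eb Ub]].
  (* [e] is injective on [A], so both ultrafilters point to the same parameter; a point common to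
     [Ua] and [Ub] shows that [a] and [b] share their coordinate. *)
  have Ebb' : b = b'.
    by apply: val_inj; apply: e_inj; rewrite ?inE ?eb ?eb' //; apply: set_valP.
  have [x [/= xa xb]] := filter_ex (filterI Ua Ub).
  by apply: filterS Ub' => y /=; rewrite /coord_eq /= -Ebb' => ->; rewrite -xb.
have flip z1 z2 : coord_eq q z1 z2 = coord_eq q z2 z1.
  by apply/seteqP; split=> x; exact: esym.
case: z z' => [i|a] [j|b]; last 1 first.
- by move=> /filter_ex[x E]; apply: filterS filterT.
- by have := E2 (i, j); rewrite !ffunE /= => E /asboolP; rewrite E => /asboolP.
- exact: main.
- by rewrite flip => /main; rewrite flip.
Qed.

End ultra_coordinates.

Section types_in_grids.
Variables (N : structure grid_lang) (X Y : Type) (p1 : N -> X) (p2 : N -> Y).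
Hypothesis G : grid p1 p2.

(** A type is determined by the codes of its ultrafilter in the two coordinates, and codes range
    over countable types. *)
Lemma grid_types_countable (A : set N) n :
  countable A -> countable (@type_space grid_lang N A n).
Proof.
move=> cA.
have [C1 [code1 code1P]] := @ultra_code N A n _ p1 cA.
have [C2 [code2 code2P]] := @ultra_code N A n _ p2 cA.
have ultra (p : set (formula grid_lang ('I_n + A))) : exists U : set_system ('I_n -> N),
    type_space p ->
    UltraFilter U /\ forall phi, p phi -> U [set x | sat_over x phi].
  have [tp|] := pselect (type_space p); last by exists set0.
  by have [U HU] := type_ultra tp; exists U.
have [U UP] := choice ultra.
apply/countable_injP; exists (fun p => pickle (code1 (U p), code2 (U p))).
suff incl p p' : type_space p -> type_space p' -> code1 (U p) = code1 (U p') ->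
    code2 (U p) = code2 (U p') -> p `<=` p'.
  move=> p p'; rewrite !inE => tp tp' /(pcan_inj pickleK)[E1 E2].
  by apply/seteqP; split; apply: incl.
move=> tp tp' E1 E2 phi pphi; have [_ /(_ phi)[//|npphi]] := tp'.
have [UU Up] := UP p tp; have [UU' Up'] := UP p' tp'.
have PU : ProperFilter (U p) := ultra_proper.
have PU' : ProperFilter (U p') := ultra_proper.
(* Points typical for the two ultrafilters have the same pattern on the variables that matter to
   [phi], yet [x] would satisfy it and [y] would not. *)
have [S [fS HS]] := grid_sat phi.
have [x [/= [x1 x2] xphi]] := filter_ex
  (filterI (filterI (ultra_patternP p1 UU fS) (ultra_patternP p2 UU fS)) (Up _ pphi)).
have [y [/= [y1 y2] yphi]] := filter_ex
  (filterI (filterI (ultra_patternP p1 UU' fS) (ultra_patternP p2 UU' fS)) (Up' _ npphi)).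
case: yphi; refine (proj1 (HS _ _ _ _ _ _ _ _ _ _ _ _ G G _ _) xphi).
  by apply: ultra_pattern_same_eq x1 y1 => z z'; split; apply: code1P.
by apply: ultra_pattern_same_eq x2 y2 => z z'; split; apply: code2P.
Qed.

(** With finitely many parameters the whole pattern of the ultrafilter lives on finitely many
    variables, and any point showing it realizes the type. *)
Lemma grid_omega_saturated : omega_saturated N.
Proof.
move=> A n p fA tp; have [U [UU Up]] := type_ultra tp.
have PU : ProperFilter U := ultra_proper.
have fV : finite_set [set: 'I_n + A].
  have fA' : finite_set [set: A].
    rewrite (_ : setT = val @^-1` A).
      by apply: finite_preimage fA => a b _ _; exact: val_inj.
    by apply/seteqP; split=> // a _; exact: set_valP.
  rewrite (_ : setT = inl @` [set: 'I_n] `|` inr @` [set: A]).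
    by rewrite finite_setU; split; apply: finite_image.
  by apply/seteqP; split=> // -[i|a] _; [left; exists i|right; exists a].
have [x [x1 x2]] := filter_ex
  (filterI (ultra_patternP p1 UU fV) (ultra_patternP p2 UU fV)).
exists x => phi pphi.
have [y [/= [y1 y2] yphi]] := filter_ex
  (filterI (filterI (ultra_patternP p1 UU fV) (ultra_patternP p2 UU fV)) (Up _ pphi)).
have [S [fS HS]] := grid_sat phi.
refine (proj1 (HS _ _ _ _ _ _ _ _ _ _ _ _ G G _ _) yphi).
  by apply: same_eqS (@subsetT _ S) (ultra_pattern_same_eq _ y1 x1).
by apply: same_eqS (@subsetT _ S) (ultra_pattern_same_eq _ y2 x2).
Qed.

End types_in_grids.

Lemma grid_omega_stable : omega_stable grid_theory.
Proof.
split; [by apply: countableP (void : countType) _ | by apply: countableP|].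
move=> N /model_grid[X [Y [p1 [p2 G]]]] A cA n; exact: grid_types_countable G A n cA.
Qed.

(** * Morley rank *)

Definition close (K a b : nat) : Prop := a = b \/ K <= a /\ K <= b.

Lemma close_eq K a b c : close K a b -> c < K -> (a = c <-> b = c).
Proof.
by move=> [->//|[Ka Kb]] cK; split=> E; [move: Ka|move: Kb]; rewrite E leqNgt cK.
Qed.

(** Coordinates from [K] on are interchangeable. A definable set has this property once [K] exceeds
    the coordinates of its parameters. *)
Definition tame K (D : set ('I_1 -> nat_grid)) : Prop :=
  forall x y, close K (x ord0).1 (y ord0).1 -> close K (x ord0).2 (y ord0).2 ->
    D x -> D y.

Lemma finite_nat_bound (B : set nat) :
  finite_set B -> exists K, forall b, B b -> b < K.
Proof.
move=> /finite_seqP[s ->]; exists (\max_(b <- s) b).+1 => b /= bs.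
by rewrite ltnS (big_rem b bs) /= leq_maxl.
Qed.

Lemma definable_tame D : definable [set: nat_grid] D -> exists K, tame K D.
Proof.
move=> [phi ->]; have [S [fS HS]] := grid_sat phi.
(* The sum bounds both coordinates of a parameter at once; the value [0] at the free variable is a
   dummy. *)
pose g (z : 'I_1 + [set: nat_grid]) :=
  if z is inr b then (val b).1 + (val b).2 else 0.
have [K HK] := finite_nat_bound (finite_image g fS).
have K1 b : S (inr b) -> (val b).1 < K.
  move=> Sb; apply: leq_ltn_trans (HK (g (inr b)) _); last by exists (inr b).
  exact: leq_addr.
have K2 b : S (inr b) -> (val b).2 < K.
  move=> Sb; apply: leq_ltn_trans (HK (g (inr b)) _); last by exists (inr b).
  exact: leq_addl.
exists K => x y c1 c2.
apply: (proj1 (HS _ _ _ _ _ _ _ _ _ _ _ _ nat_grid_grid nat_grid_grid _ _)).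
- move=> [i|a] [j|b] Sz Sz' /=; rewrite ?ord1 //.
    exact: close_eq c1 (K1 _ Sz').
  by split=> /esym/(close_eq c1 (K1 _ Sz))/esym.
- move=> [i|a] [j|b] Sz Sz' /=; rewrite ?ord1 //.
    exact: close_eq c2 (K2 _ Sz').
  by split=> /esym/(close_eq c2 (K2 _ Sz))/esym.
Qed.

(** Disjoint nonempty sets provide infinitely many points, which do not fit into the square of side
    [K]. *)
Lemma rank1_outside_square (D : set ('I_1 -> nat_grid)) K :
  morley_rank_ge 1 D ->
  exists x, D x /\ (K <= (x ord0).1 \/ K <= (x ord0).2).
Proof.
move=> [Y [HY disj]].
have [y Hy] := choice (fun i => let: And3 _ _ ne := HY i in ne).
have y_inj i j : y i ord0 = y j ord0 -> i = j.
  move=> E; apply: contrapT => /disj; rewrite -subset0 => /(_ (y i)); apply.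
  split=> //; rewrite (_ : y i = y j) //; apply/funext => o; by rewrite ord1.
have inf : infinite_set (range (fun i => y i ord0)).
  apply/infiniteP; have : {in [set: nat] &, injective (fun i => y i ord0)}.
    by move=> i j _ _; exact: y_inj.
  by move/inj_card_eq; rewrite card_eq_le => /andP[].
have [_ [[i _ <-] out]] := infinite_fresh inf (finite_setX (finite_II K) (finite_II K)).
exists (y i); split; first by have [_ sub _] := HY i; exact: sub.
case: (leqP K (y i ord0).1) => lt1; first by left.
case: (leqP K (y i ord0).2) => lt2; first by right.
by case: out; split.
Qed.

Lemma nat_finType_not_injective (T : finType) (f : nat -> T) :
  exists i j, i <> j /\ f i = f j.
Proof.
apply: contrapT => no.
have f_inj : injective (fun i : 'I_#|T|.+1 => f i).
  move=> i j E; apply: val_inj; apply: contrapT => ne; apply: no.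
  by exists (val i), (val j).
by have := leq_card _ f_inj; rewrite card_ord ltnn.
Qed.

(* Otherwise [D] lies in [K] rows and [K] columns, and each of infinitely many
   disjoint infinite tame subsets contains an end of one of these lines. *)
Lemma rank2_generic (D : set ('I_1 -> nat_grid)) K :
  morley_rank_ge 2 D ->
  exists x, [/\ D x, K <= (x ord0).1 & K <= (x ord0).2].
Proof.
move=> [Z [HZ disj]]; apply: contrapT => no.
have thin x : D x -> (x ord0).1 < K \/ (x ord0).2 < K.
  move=> Dx; case: ltnP => K1; first by left.
  by case: ltnP => K2; [right|case: no; exists x].
pose line (e : 'I_K + 'I_K) m : 'I_1 -> nat_grid :=
  fun=> match e with inl j => (m, val j) | inr j => (val j, m) end.
have ends i : exists e, exists B, forall m, B <= m -> Z i (line e m).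
  have [defZ ZD rZ] := HZ i; have [B tZ] := definable_tame defZ.
  (* Beyond [K], so that the other coordinate of [x] must be below [K]; beyond [B], so that tameness
     carries [x] along its line. *)
  have [x [Zx]] := rank1_outside_square (maxn K B) rZ.
  rewrite !geq_max => -[/andP[Kx Bx]|/andP[Kx Bx]].
    have [|x2] := thin x (ZD x Zx); first by rewrite ltnNge Kx.
    exists (inl (Ordinal x2)), B => m Bm; apply: tZ Zx; last by left.
    by right.
  have [x1|] := thin x (ZD x Zx); last by rewrite ltnNge Kx.
  exists (inr (Ordinal x1)), B => m Bm; apply: tZ Zx; first by left.
  by right.
have [e eP] := choice ends.
have [i [j [/disj dij eij]]] := nat_finType_not_injective e.
have [B HB] := eP i; have [B' HB'] := eP j.
have : (Z i `&` Z j) (line (e i) (maxn B B')).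
  by split; [apply: HB|rewrite eij; apply: HB']; rewrite ?leq_maxl ?leq_maxr.
by rewrite dij.
Qed.

(** A tame set contains all or none of the points with both coordinates beyond its bound, so two
    disjoint definable sets cannot both have rank at least 2. *)
Lemma nat_grid_rank_lt3 : ~ morley_rank_ge 3 [set: 'I_1 -> nat_grid].
Proof.
move=> [Y [HY disj]].
have [def0 _ r0] := HY 0; have [def1 _ r1] := HY 1.
have [K0 t0] := definable_tame def0.
have [x [Yx x1 x2]] := rank2_generic K0 r0.
have [y [Yy y1 y2]] := rank2_generic K0 r1.
have : (Y 0 `&` Y 1) y by split=> //; apply: t0 Yx; right.
by rewrite disj.
Qed.

Lemma nat_grid_rank_ge2 : morley_rank_ge 2 [set: 'I_1 -> nat_grid].
Proof.
exists (fun i => [set x | (x ord0).1 = i]); split; last first.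
  by move=> i j ne; apply/seteqP; split=> // x [/= xi xj]; case: ne; rewrite -xi -xj.
move=> i; split=> //.
  pose c j : [set: nat_grid] := SigSub (mem_set (I : [set: nat_grid] (i, j))).
  (* Two named points of row [i] give its direction, and [x] is on it when the line from [x] to the
     first of them is parallel. *)
  exists (Par (inr (c 0)) (inr (c 1)) (inl ord0) (inr (c 0))).
  apply/seteqP; split=> x; rewrite /= /sat_over sat_Par (grid_par nat_grid_grid) /=.
    by move=> E; split=> //; left.
  by move=> [_ [[_ ->]|[]]].
exists (fun j => [set x | x ord0 = (i, j)]); split; last first.
  by move=> j j' ne; apply/seteqP; split=> // x [/= xj]; rewrite xj => -[/ne].
move=> j; split=> [||]; last by exists (fun=> (i, j)).
  pose c : [set: nat_grid] := SigSub (mem_set (I : [set: nat_grid] (i, j))).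
  by exists (Equal (Var _ (inl ord0)) (Var _ (inr c))).
by move=> x /= ->.
Qed.

Lemma grid_theory_rank : has_morley_rank grid_theory 2.
Proof.
exists nat_grid; split; [by [] | exact: grid_omega_saturated nat_grid_grid
  | exact: nat_grid_rank_ge2 | exact: nat_grid_rank_lt3].
Qed.

(** * A set that is not benign *)

Section expansion.
Variables (N : structure grid_lang) (A : set N) (V : Type) (v : V -> expand A).

Definition expPar (a b c d : V) : formula (add_pred grid_lang) V :=
  @Rel (add_pred grid_lang) V (Some tt)
    (quad (Var _ a) (Var _ b) (Var _ c) (Var _ d)).

Definition inP (a : V) : formula (add_pred grid_lang) V :=
  @Rel (add_pred grid_lang) V None (fun=> Var _ a).

Lemma sat_expPar a b c d :
  sat v (expPar a b c d) <-> par (v a : N) (v b) (v c) (v d).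
Proof.
rewrite /expPar /par /=; set f := (X in rel_interp X <-> _).
suff -> : f = quad (v a) (v b) (v c) (v d) by [].
by apply/funext; case=> -[|[|[|[|i]]]].
Qed.

Lemma sat_inP a : sat v (inP a) <-> A (v a).
Proof. by []. Qed.

End expansion.

Definition succ_graph : set nat_grid := [set a | a.2 = a.1.+1].

(** The two points are the remaining corners of the rectangle spanned by the graph points [(0, 1)]
    and [(1, 2)]. Each point of the graph is determined by either coordinate, so the exchange
    respects all equalities of coordinates. *)
Lemma succ_graph_same_type :
  @same_type grid_lang nat_grid succ_graph 1 (fun=> (0, 2)) (fun=> (1, 1)).
Proof.
move=> phi; have [S [fS HS]] := grid_sat phi.
(* The second valuation is read with rows and columns exchanged. *)
apply: HS nat_grid_grid (grid_swap nat_grid_grid) _ _.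
- move=> [i|[a /set_mem/= Ea]] [j|[b /set_mem/= Eb]] _ _ //=; rewrite ?Ea ?Eb.
  + by split=> [<-|[]].
  + by split=> [->|[]].
  + by split=> [->|[]].
- move=> [i|[a /set_mem/= Ea]] [j|[b /set_mem/= Eb]] _ _ //=; rewrite ?Ea ?Eb.
  + by split=> [[]|<-].
  + by split=> [[]|->].
  + by split=> [[]|->].
Qed.

Definition base_point : succ_graph :=
  SigSub (mem_set (erefl : succ_graph (0, 1))).

(* Some point of the line through [x] and the base point is not collinear with
   any point of the graph other than the base point. *)
Definition free_point : formula (add_pred grid_lang) ('I_1 + succ_graph) :=
  let x := inl ord0 in let a := inr base_point in
  Ex (And (expPar (Some x) (Some a) (Some x) None)
    (And (Not (Equal (Var _ None) (Var _ (Some a))))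
      (Forall (Imp (inP None)
        (Imp (expPar (Some None) None (Some None) None)
          (Equal (Var _ None) (Var _ (Some (Some a))))))))).

Lemma sat_free_point (x : 'I_1 -> nat_grid) :
  sat_over (M := expand succ_graph) x free_point <->
  exists q, [/\ @par nat_grid (x ord0) (0, 1) (x ord0) q, q <> (0, 1) &
    forall b, succ_graph b -> @par nat_grid q b q b -> b = (0, 1)].
Proof.
rewrite /sat_over /free_point; split=> [/sat_Ex[q]|[q [H1 H2 H3]]].
  rewrite !sat_And sat_expPar => -[H1 [H2 /sat_Forall H3]].
  exists q; split=> // b Pb qb; move: (H3 b).
  by rewrite !sat_Imp sat_inP sat_expPar; apply.
apply/sat_Ex; exists q; rewrite !sat_And sat_expPar; split=> //; split=> //.
by apply/sat_Forall => b; rewrite !sat_Imp sat_inP sat_expPar; exact: H3.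
Qed.

Lemma succ_graph_not_benign : ~ @benign grid_lang nat_grid succ_graph.
Proof.
move=> /(_ _ _ _ succ_graph_same_type)/(_ free_point)[+ _].
rewrite !sat_free_point; case.
  (* From [(0, 2)] the line is row [0], and [(0, 0)] lies in the column that misses the graph. *)
  exists (0, 0); split=> //; first by rewrite (grid_par nat_grid_grid); split=> //; left.
  move=> [r s] E; rewrite (grid_collinear nat_grid_grid).
  by rewrite /succ_graph /= in E; rewrite E => -[_ [/= <-|]].
(* From [(1, 1)] the line is column [1]; its point [(r, 1)] shares a row with the graph point
   [(r, r.+1)], which is not the base point unless [r = 0]. *)
move=> [r s] [].
rewrite (grid_par nat_grid_grid) => -[_ [[//]|[_ E]]].
have {E} <- : 1 = s by [].
move=> ne H; apply: (ne); have := H (r, r.+1) erefl.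
rewrite (grid_collinear nat_grid_grid) => E.
have [->//] : (r, r.+1) = (0, 1).
by apply: E; split; [case=> r0; apply: ne; rewrite -r0|left].
Qed.

(** * Elementary maps and indiscernible sequences *)

Section elementary_maps.
Variables (N C : structure grid_lang) (A : set N) (f : N -> C).
Hypothesis f_elem : elementary_on A f.

Lemma elementary_par a b c d : A a -> A b -> A c -> A d ->
  (par a b c d <-> par (f a) (f b) (f c) (f d)).
Proof.
move=> Aa Ab Ac Ad; pose o k (lt : k < 4) := Ordinal lt.
have := f_elem (Par (@o 0 isT) (@o 1 isT) (@o 2 isT) (@o 3 isT)) (a := quad a b c d).
by rewrite !sat_Par; apply; case=> -[|[|[|[|i]]]].
Qed.

Lemma elementary_inj a b : A a -> A b -> f a = f b -> a = b.
Proof.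
move=> Aa Ab; pose v (i : 'I_2) := if i == ord0 then a else b.
have Av i : A (v i) by rewrite /v; case: ifP.
by have /= [_] := f_elem (Equal (Var _ ord0) (Var _ ord_max)) Av.
Qed.

End elementary_maps.

Lemma infinite_injection T (R : set T) : infinite_set R ->
  exists h : nat -> T, injective h /\ forall n, R (h n).
Proof.
move=> /infiniteP/card_leP[f].
exists (fun n => val (f (SigSub (mem_set (I : [set: nat] n))))); split.
  move=> m n /val_inj E.
  suff [] : SigSub (mem_set (I : [set: nat] m)) =
    SigSub (mem_set (I : [set: nat] n)) by [].
  by apply: (@inj _ _ _ f) E; rewrite inE.
by move=> n; exact: set_valP.
Qed.

(* A sequence of copies of [c], starting at [c], that is indiscernible over
   [B]. *)
Lemma spread T (B R : set T) n (c : 'I_n -> T) :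
  finite_set B -> infinite_set R -> B `<=` R ->
  exists g : nat -> 'I_n -> T,
  [/\ g 0 = c, forall k i, R (g k.+1 i),
      forall k k' i b, B b -> (g k i = b <-> g k' i = b) &
      forall k l k' l' i j, (k = l <-> k' = l') ->
        (g k i = g l j <-> g k' i = g l' j)].
Proof.
move=> fB iR BR.
have fin : finite_set (B `|` range c) by rewrite finite_setU; split=> //;
  exact: finite_image.
have [h [h_inj hR]] := infinite_injection (infinite_setD iR fin).
(* A canonical index for the value [c i], so that equal entries of [c] receive equal copies. *)
pose cls i : option 'I_n := [pick j | `[< c j = c i >]].
have clsP i j : cls i = cls j <-> c i = c j.
  split=> [|E]; last by rewrite /cls E.
  rewrite /cls; case: pickP => [k /asboolP <-|/(_ i)/asboolP//].
  by case: pickP => [k' /asboolP <- [->]|].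
(* Entries in [B] stay put. The others become fresh values indexed by copy and class, except in copy
   [0], which is [c] itself. *)
pose g k i := if pselect (B (c i)) then c i else
  if k is k'.+1 then h (pickle (k', cls i)) else c i.
have hB m : ~ B (h m) by move=> Bh; case: (hR m) => _; apply; left.
have hc m i : h m <> c i by move=> E; case: (hR m) => _; apply; right; exists i.
have gB k i : B (g k i) <-> B (c i).
  by rewrite /g; case: pselect => //; case: k => // k nB; split=> // /hB.
have gE k i : B (c i) -> g k i = c i by rewrite /g; case: pselect.
have gI k l i j : ~ B (c i) -> ~ B (c j) -> (g k i = g l j <-> k = l /\ c i = c j).
  move=> nBi nBj; rewrite /g; case: pselect => //= _; case: pselect => //= _.
  case: k l => [|k] [|l].
  - by split=> [|[]].
  - by split=> [/esym/hc|[]].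
  - by split=> [/hc|[]].
  - by split=> [/h_inj/(pcan_inj pickleK)[-> /clsP]|[[->] /clsP ->]].
exists g; split.
- by apply/funext => i; rewrite /g; case: pselect.
- move=> k i; rewrite /g; case: pselect => [/BR //|nB] /=.
  by case: (hR (pickle (k, cls i))).
- move=> k k' i b Bb; have [Bi|nBi] := pselect (B (c i)); first by rewrite !gE.
  by split=> E; case: nBi; [apply/(gB k i)|apply/(gB k' i)]; rewrite E.
- move=> k l k' l' i j kl.
  have [Bi|nBi] := pselect (B (c i)); have [Bj|nBj] := pselect (B (c j)).
  + by rewrite !gE.
  + by split=> E; case: nBj; [apply/(gB l j)|apply/(gB l' j)]; rewrite -E; apply/gB.
  + by split=> E; case: nBi; [apply/(gB k i)|apply/(gB k' i)]; rewrite E; apply/gB.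
  + by rewrite !gI // kl.
Qed.

(** * Submodels of grids *)

Section submodels.
Variables (C : structure grid_lang) (X Y : Type) (p1 : C -> X) (p2 : C -> Y).
Hypothesis G : grid p1 p2.

(** Two points in different rows and columns have exactly two common neighbours for collinearity,
    the remaining corners of their rectangle. *)
Definition Corners : formula grid_lang 'I_2 :=
  let p := Some (Some ord0) in let q := Some (Some ord_max) in
  let r := Some None in let s := None in
  Ex (Ex (And (Not (Equal (Var _ r) (Var _ s)))
    (And (And (Par p r p r) (Par q r q r)) (And (Par p s p s) (Par q s q s))))).

Lemma sat_Corners (N : structure grid_lang) (v : 'I_2 -> N) :
  sat v Corners <->
  exists r s, [/\ r <> s, par (v ord0) r (v ord0) r, par (v ord_max) r (v ord_max) r,
    par (v ord0) s (v ord0) s & par (v ord_max) s (v ord_max) s].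
Proof.
rewrite /Corners; split=> [/sat_Ex[r /sat_Ex[s]]|[r [s [rs H1 H2 H3 H4]]]].
  by rewrite !sat_And !sat_Par => -[rs [[H1 H2] [H3 H4]]]; exists r, s.
by apply/sat_Ex; exists r; apply/sat_Ex; exists s; rewrite !sat_And !sat_Par.
Qed.

(** [Corners] does not tell the two corners apart, but elementarity puts two distinct common
    neighbours into [S], and they cannot both be the wrong corner. *)
Lemma elementary_submodel_rect S p q : elementary_submodel S -> S p -> S q ->
  exists r, [/\ S r, p1 r = p1 p & p2 r = p2 q].
Proof.
move=> [N [f [f_elem ->]]] [x _ <-] [y _ <-].
have [E1|n1] := pselect (p1 (f x) = p1 (f y)); first by exists (f y); split=> //; exists y.
have [E2|n2] := pselect (p2 (f x) = p2 (f y)); first by exists (f x); split=> //; exists x.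
have [r [r1 r2]] := grid_rect G (f x) (f y).
have [s [s1 s2]] := grid_rect G (f y) (f x).
pose v (i : 'I_2) := if i == ord0 then x else y.
have : sat v Corners.
  apply/(f_elem _ _ v (fun _ => I))/sat_Corners; exists r, s; split.
  - by move=> E; apply: n1; rewrite -r1 E.
  - apply/(grid_collinear G); split; last by left.
    by move=> E; apply: n2; rewrite -r2 -E.
  - apply/(grid_collinear G); split; last by right.
    by move=> E; apply: n1; rewrite -r1 -E.
  - apply/(grid_collinear G); split; last by right.
    by move=> E; apply: n1; rewrite -s1 -E.
  - apply/(grid_collinear G); split; last by left.
    by move=> E; apply: n2; rewrite -s2 -E.
move=> /sat_Corners[t [u [tu]]]; rewrite /v /=.
have pr (a b : N) : par a b a b ->
    f a <> f b /\ (p1 (f a) = p1 (f b) \/ p2 (f a) = p2 (f b)).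
  by move=> /(elementary_par f_elem I I I I)/(grid_collinear G).
move=> /pr[_ xt] /pr[_ yt] /pr[_ xu] /pr[_ yu].
have ftu : f t <> f u by move/(elementary_inj f_elem I I).
case: xt yt => [xt|xt] [yt|yt].
- by case: n1; rewrite xt.
- by exists (f t); split=> //; exists t.
- case: xu yu => [xu|xu] [yu|yu].
  + by case: n1; rewrite xu.
  + by exists (f u); split=> //; exists u.
  + by case: ftu; apply: (grid_inj G); rewrite -?xt -?yt.
  + by case: n2; rewrite xu.
- by case: n2; rewrite xt.
Qed.

Lemma elementary_submodel_infinite S : elementary_submodel S ->
  infinite_set (p1 @` S) /\ infinite_set (p2 @` S).
Proof.
move=> [N [f [f_elem ->]]]; have [x] := carrier_inhabited N.
have scat k : exists h : nat -> N, forall i j, i < j < k -> apart (f (h j)) (f (h i)).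
  have /sat_Scattered_seq[h [hij _]] : sat (fun _ : 'I_1 => x) (Scattered k [::]).
    by apply/(f_elem _ _ _ (fun _ => I)); exact: grid_Scattered G _ _ _ _.
  exists h => i j /hij[ne np]; split; first by move/(elementary_inj f_elem I I).
  by move/(elementary_par f_elem I I I I).
split; rewrite (image_comp f _ setT); apply: infinite_range_seq => k;
  have [h hij] := scat k; exists h => i j /hij/(grid_apart G)[ne1 ne2] //.
Qed.

Section box.
Variables (R1 : set X) (R2 : set Y).
Hypotheses (R1_infinite : infinite_set R1) (R2_infinite : infinite_set R2).
Hypotheses (R1_range : R1 `<=` range p1) (R2_range : R2 `<=` range p2).

Definition box : set C := [set p | R1 (p1 p) /\ R2 (p2 p)].

Lemma box_point x y : R1 x -> R2 y -> exists p, [/\ box p, p1 p = x & p2 p = y].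
Proof.
move=> R1x R2y; have [q1 _ e1] := R1_range R1x; have [q2 _ e2] := R2_range R2y.
have [p [ep1 ep2]] := grid_rect G q1 q2.
by exists p; rewrite /box /= ep1 ep2 e1 e2.
Qed.

Lemma box_inhabited : inhabited box.
Proof.
have [x R1x] := infinite_setN0 R1_infinite; have [y R2y] := infinite_setN0 R2_infinite.
by have [p [bp _ _]] := box_point R1x R2y; exact: (inhabits (SigSub (mem_set bp))).
Qed.

Definition box_structure : structure grid_lang :=
  {| carrier := box;
     carrier_inhabited := box_inhabited;
     func_interp := fun f : func grid_lang => match f with end;
     rel_interp := fun (r : rel_sym grid_lang) (u : 'I_4 -> box) =>
       @rel_interp grid_lang C r (val \o u) |}.

Lemma box_grid : @grid box_structure X Y (p1 \o val) (p2 \o val).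
Proof.
split=> /=.
- by move=> p q E1 E2; apply: val_inj; exact: (grid_inj G).
- move=> [p bp] [q bq]; have [Rp _] := set_mem bp; have [_ Rq] := set_mem bq.
  by have [r [br r1 r2]] := box_point Rp Rq; exists (SigSub (mem_set br)).
- apply: (sub_infinite_set _ R1_infinite) => x R1x.
  have [y R2y] := infinite_setN0 R2_infinite.
  by have [p [bp <- _]] := box_point R1x R2y; exists (SigSub (mem_set bp)).
- apply: (sub_infinite_set _ R2_infinite) => y R2y.
  have [x R1x] := infinite_setN0 R1_infinite.
  by have [p [bp _ <-]] := box_point R1x R2y; exists (SigSub (mem_set bp)).
- move=> a b c d; rewrite /par /=.
  suff -> : val \o quad a b c d = quad (val a) (val b) (val c) (val d).
    have := grid_par G (val a) (val b) (val c) (val d); rewrite /par => ->.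
    rewrite /parallel; split=> -[ne H]; split=> //; first by move=> E; apply: ne; rewrite E.
    by move/val_inj.
  by apply/funext; case=> -[|[|[|[|i]]]].
Qed.

(** The inclusion changes no coordinate, so [grid_sat] applies to it. *)
Lemma box_elementary : elementary_submodel box.
Proof.
exists box_structure, val; split; last first.
  apply/seteqP; split=> [p bp|_ [p _ <-]]; last exact: set_valP.
  by exists (SigSub (mem_set bp)).
move=> n phi a _; have [S [_ HS]] := grid_sat phi.
exact: HS box_grid G _ _.
Qed.

(** Spreading [c] in both coordinates gives a sequence [d] with [d 0 = c] and [d 1] in the box, in
    which all ordered pairs of distinct members have the same type over [B]. An equivalence relation
    with finitely many classes relates one such pair, hence all. *)
Lemma box_strong_type (B : set C) n (c : 'I_n -> C) :
  finite_set B -> B `<=` box ->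
  exists c', (forall i, box (c' i)) /\ same_strong_type B c' c.
Proof.
move=> fB Bbox.
have [|g1 [g10 g1R g1B g1I]] := spread (p1 \o c) (finite_image p1 fB) R1_infinite.
  by move=> _ [b /Bbox[] + _ <-].
have [|g2 [g20 g2R g2B g2I]] := spread (p2 \o c) (finite_image p2 fB) R2_infinite.
  by move=> _ [b /Bbox[] _ + <-].
have pts k : exists d : 'I_n -> C, [/\ p1 \o d = g1 k, p2 \o d = g2 k &
    forall i, 0 < k -> box (d i)].
  case: k => [|k]; first by exists c.
  have [d dP] := choice (fun i => box_point (g1R k i) (g2R k i)).
  exists d; split=> [||i _]; [apply/funext => i..|]; by have [] := dP i.
have [d dP] := choice pts.
have d1 k i : p1 (d k i) = g1 k i by have [<-] := dP k.
have d2 k i : p2 (d k i) = g2 k i by have [_ <-] := dP k.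
have d0 : d 0 = c.
  by apply/funext => i; apply: (grid_inj G); rewrite ?d1 ?d2 ?g10 ?g20.
exists (d 1); split; first by move=> i; have [_ _] := dP 1; apply.
rewrite -d0 => E [phi Ephi] refl sym trans [m [r cover]].
pose v k l : ('I_n + 'I_n) + B -> C :=
  join_val (join_val (d k) (d l)) (fun b : B => val b).
have pattern Z (p : C -> Z) (g : nat -> 'I_n -> Z) :
    (forall k i, p (d k i) = g k i) ->
    (forall k k' i b, (p @` B) b -> (g k i = b <-> g k' i = b)) ->
    (forall k l k' l' i j, (k = l <-> k' = l') -> (g k i = g l j <-> g k' i = g l' j)) ->
    forall S k l k' l', k <> l -> k' <> l' -> same_eq S (p \o v k l) (p \o v k' l').
  move=> pd gB gI S k l k' l' kl kl' z z' _ _.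
  have PB (b : B) : (p @` B) (p (val b)) by exists (val b) => //; exact: set_valP.
  have flip x1 x2 y1 y2 : (x1 = x2 <-> y1 = y2) -> (x2 = x1 <-> y2 = y1 :> Z).
    by move=> [H1 H2]; split=> /esym; [move/H1|move/H2].
  case: z z' => [[i|i]|b] [[j|j]|b'] /=; rewrite ?pd //.
  - exact: gI.
  - by apply: gI; split=> [/kl|/kl'].
  - exact: gB (PB _).
  - by apply: gI; split=> /esym; [move/kl|move/kl'].
  - exact: gI.
  - exact: gB (PB _).
  - by apply: flip; exact: gB (PB _).
  - by apply: flip; exact: gB (PB _).
have Epairs k l k' l' : k <> l -> k' <> l' ->
    E (join_val (d k) (d l)) -> E (join_val (d k') (d l')).
  move=> kl kl'; have [S [fS HS]] := grid_sat phi; rewrite Ephi.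
  apply: (proj1 (HS _ _ _ _ _ _ _ _ _ _ (v k l) (v k' l') G G _ _)).
    exact: pattern d1 g1B g1I _ _ _ _ _ kl kl'.
  exact: pattern d2 g2B g2I _ _ _ _ _ kl kl'.
have [e eP] := choice (fun k => cover (d k)).
have [k [l [kl ekl]]] := nat_finType_not_injective e.
apply: (Epairs k l 1 0) => //; apply: trans (eP k) _.
by rewrite ekl; apply: sym; exact: eP.
Qed.

Lemma box_a_saturated : a_saturated box.
Proof.
by split; [exact: box_elementary | move=> B fB Bbox n c; exact: box_strong_type].
Qed.

End box.

(** The points [a] and [b] name the two directions at [o]; an elementary map fixing all three cannot
    exchange rows and columns. *)
Lemma submodel_axes S : elementary_submodel S ->
  exists o a b, [/\ S o, S a, S b, a <> o /\ p1 a = p1 o & b <> o /\ p2 b = p2 o].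
Proof.
move=> eS; have [i1 i2] := elementary_submodel_infinite eS.
have [_ [o So _]] := infinite_setN0 i1.
have [_ [[q1 Sq1 <-] n1]] := infinite_fresh i1 (finite_set1 (p1 o)).
have [_ [[q2 Sq2 <-] n2]] := infinite_fresh i2 (finite_set1 (p2 o)).
have [a [Sa a1 a2]] := elementary_submodel_rect eS So Sq2.
have [b [Sb b1 b2]] := elementary_submodel_rect eS Sq1 So.
exists o, a, b; split=> //; split=> // E.
  by apply: n2; rewrite /= -a2 E.
by apply: n1; rewrite /= -b1 E.
Qed.

Lemma par_row o a p q : a <> o -> p1 a = p1 o -> (par o a p q <-> p1 p = p1 q).
Proof.
move=> ao a1; rewrite (grid_par G) /parallel a1.
split=> [[_ [[]|[E]]] //|]; first by case: ao; apply: (grid_inj G).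
by move=> E; split; [exact/nesym | left].
Qed.

(** * Spans and NDOP *)

Section span.
Variable M : set C.

Definition span : set C := box (p1 @` M) (p2 @` M).

Lemma sub_span : M `<=` span.
Proof. by move=> p Mp; split; exists p. Qed.

Lemma span_sub S : elementary_submodel S -> M `<=` S -> span `<=` S.
Proof.
move=> eS MS p [[m Mm m1] [m' Mm' m2]].
have [r [Sr r1 r2]] := elementary_submodel_rect eS (MS _ Mm) (MS _ Mm').
by rewrite (_ : p = r) //; apply: (grid_inj G); rewrite ?r1 ?r2.
Qed.

End span.
End submodels.

(* An elementary map preserves the rows because one line of [S] is fixed. *)
Lemma elementary_fixes_span (C : structure grid_lang) X Y (p1 : C -> X) (p2 : C -> Y)
    (S M N : set C) (g : C -> C) :
  grid p1 p2 -> elementary_submodel S -> S `<=` M -> M `<=` N ->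
  elementary_on N g -> (forall x, M x -> g x = x) ->
  forall x, N x -> span p1 p2 M x -> g x = x.
Proof.
move=> G eS SM MN g_elem gM x Nx [[m Mm m1] [m' Mm' m2]].
have [o [a [b [So Sa Sb [ao a1] [bo b2]]]]] := submodel_axes G eS.
have fix_par c q : S c -> M q -> par o c q x -> par o c q (g x).
  move=> Sc Mq; have [Mo Mc] := (SM _ So, SM _ Sc).
  move/(elementary_par g_elem (MN _ Mo) (MN _ Mc) (MN _ Mq) Nx).
  by rewrite (gM o) // (gM c) // (gM q).
apply: (grid_inj G).
  rewrite -m1; apply/esym; apply/(par_row G _ _ ao a1).
  by apply: fix_par => //; apply/(par_row G _ _ ao a1).
rewrite -m2; apply/esym; apply/(par_row (grid_swap G) _ _ bo b2).
by apply: fix_par => //; apply/(par_row (grid_swap G) _ _ bo b2).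
Qed.

Lemma grid_theory_ndop : ndop grid_theory.
Proof.
move=> [C [/model_grid[X [Y [p1 [p2 G]]]] [_ [M0 [M1 [M2 [N]]]]]]].
move=> [[_ [_ [eM1 _]] _] [_ _ [aN MN Nprime] notmin]].
have [smallN [eN _]] := aN.
set M := M1 `|` M2 in MN Nprime notmin *.
have M1M : M1 `<=` M by move=> x; left.
have [i1 i2] := elementary_submodel_infinite G eM1.
have spanN := span_sub G eN MN.
have a_span : a_model (span p1 p2 M).
  split.
    by move=> le; apply: smallN; apply: card_le_trans le (subset_card_le spanN).
  apply: (box_a_saturated G).
  - by apply: sub_infinite_set i1; exact: image_subset.
  - by apply: sub_infinite_set i2; exact: image_subset.
  - by move=> _ [p _ <-]; exists p.
  - by move=> _ [p _ <-]; exists p.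
(* Primeness maps [N] into the span by a map that is the identity on [M], hence on the span. *)
have [g [g_elem gspan gM]] := Nprime _ a_span (@sub_span _ _ _ p1 p2 M).
have fix_span := elementary_fixes_span G eM1 M1M MN g_elem gM.
have Nspan : N `<=` span p1 p2 M.
  (* [g x] lies in the span and is fixed, so [x] and [g x] have the same image under the injective
     map [g]. *)
  move=> x Nx; have gx := gspan x Nx.
  by rewrite -(elementary_inj g_elem (spanN _ gx) Nx (fix_span _ (spanN _ gx) gx)).
(* Thus [N] is the span, which every a-model containing [M] includes. *)
apply: notmin; split=> // N' [_ [eN' _]] MN' N'N.
apply/seteqP; split=> // x /Nspan; exact: (span_sub G eN' MN').
Qed.

Theorem lemma0p3 :
  exists (L : language) (T : set (sentence L)),
    [/\ complete_theory T, omega_stable T, has_morley_rank T 2, ndop T &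
        exists (M : structure L) (A : set M), models M T /\ ~ benign A].
Proof.
exists grid_lang, grid_theory; split.
- exact: grid_theory_complete.
- exact: grid_omega_stable.
- exact: grid_theory_rank.
- exact: grid_theory_ndop.
- exists nat_grid, succ_graph; split; last exact: succ_graph_not_benign.
  by move=> phi.
Qed.
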